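(* Let $\mathbf{u}$ be a (right-sided infinite) sequence over a finite alphabet. The equality $r_{\mathbf{u}}(n+2)=r_{\mathbf{u}}(n)+1$ holds for all sufficiently large $n$ if and only if $\mathbf{u}$ is quasi-Sturmian and there is a suffix of $\mathbf{u}$ (i.e. a sequence $u_ku_{k+1}u_{k+2}\cdots$ for some $k\in\mathbb{N}$, where $\mathbf{u}=u_0u_1u_2\cdots$) whose language is closed under reversal.
   Context: $\mathbb{N}$ includes $0$. For a sequence $\mathbf{u}=u_0u_1u_2\cdots$ over a finite alphabet, $\mathcal{L}_n(\mathbf{u})=\{u_iu_{i+1}\cdots u_{i+n-1} : i\in\mathbb{N}\}$ is the set of factors of $\mathbf{u}$ of length $n$, $\mathcal{L}(\mathbf{u})=\bigcup_{n\in\mathbb{N}}\mathcal{L}_n(\mathbf{u})$ is its language, and $\mathcal{C}_{\mathbf{u}}(n)=\#\mathcal{L}_n(\mathbf{u})$ is its factor complexity. A sequence $\mathbf{u}$ is quasi-Sturmian if there exist $n_0\in\mathbb{N}$ and a constant $c\in\mathbb{N}$ such that $\mathcal{C}_{\mathbf{u}}(n)=n+c$ for every $n\in\mathbb{N}$, $n\ge n_0$. The reversal of a word $w=w_0w_1\cdots w_{n-1}$ is $\overline{w}=w_{n-1}\cdots w_1w_0$. The language of a sequence is closed under reversal if for each factor $w$ of the sequence, $\overline{w}$ is also a factor. Two words $u,v$ are (reflectively) equivalent, $u\sim_r v$, if $u=v$ or $u=\overline{v}$. The reflection complexity of $\mathbf{u}$ is the map $r_{\mathbf{u}}:\mathbb{N}\to\mathbb{N}$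 where $r_{\mathbf{u}}(n)$ is the number of distinct elements of $\mathcal{L}_n(\mathbf{u})$ up to the equivalence $\sim_r$. *)

(* Defs.v *)
From mathcomp Require Import all_boot.
From mathcomp Require Import boolp.

Set Implicit Arguments.
Unset Strict Implicit.
Unset Printing Implicit Defensive.

Definition window (A : finType) (u : nat -> A) (i n : nat) : n.-tuple A :=
  [tuple u (i + j) | j < n].

(* Membership of a word in L_n(u) is undecidable in general, hence `[< _ >]. *)
Definition factors (A : finType) (u : nat -> A) (n : nat) :
    {set n.-tuple A} :=
  [set w : n.-tuple A | `[< exists i : nat, w = window u i n >]].

(* L(u), the union over n of the L_n(u), as a set of words of any length. *)
Definition language (A : finType) (u : nat -> A) (w : seq A) : Prop :=
  exists n : nat, exists2 v : n.-tuple A, v \in factors u n & tval v = w.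

Definition complexity (A : finType) (u : nat -> A) (n : nat) : nat :=
  #|factors u n|.

Definition quasi_sturmian (A : finType) (u : nat -> A) : Prop :=
  exists n0 c : nat, forall n : nat, n0 <= n -> complexity u n = n + c.

Definition closed_under_reversal (A : finType) (u : nat -> A) : Prop :=
  forall w : seq A, language u w -> language u (rev w).

Definition refl_equiv (A : finType) (n : nat) : rel (n.-tuple A) :=
  fun v w => (v == w) || (v == rev_tuple w).

Lemma refl_equiv_equivalence (A : finType) (n : nat) :
  equivalence_rel (@refl_equiv A n).
Proof.
have revK (w : n.-tuple A) : rev_tuple (rev_tuple w) = w.
  by apply/val_inj; rewrite /= revK.
move=> x y z; rewrite /refl_equiv; split; first by rewrite eqxx.
case/orP=> /eqP ->; first by [].
by rewrite (inj_eq (can_inj revK)) (can2_eq revK revK) orbC.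
Qed.

Definition reflection_complexity (A : finType) (u : nat -> A) (n : nat) : nat :=
  #|equivalence_partition (@refl_equiv A n) (factors u n)|.

Definition suffix_from (A : finType) (u : nat -> A) (k : nat) : nat -> A :=
  fun i => u (k + i).

(* Main.v *)
Require Import Defs.
From mathcomp Require Import all_boot.
From mathcomp Require Import boolp zify.

(** Among the factors of length [n], let [C] count all of them, [I] those whose
    reversal is not a factor (the irreversible ones) and [P] the palindromes.
    Every class up to reversal contributes 2 to [C + I + P], whence
    [2 r = C + I + P] ([double_card_classes]). Everything follows from counting
    these three quantities.

    Suppose [u] is quasi-Sturmian and its suffix [v] is closed under reversal.
    The number of factors of [u] that [v] loses is nondecreasing in [n] and
    bounded, hence eventually constant, and so [v] too eventually gains exactly
    one factor each time [n] grows by one. For large [n] the irreversible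
    factors of [u] are exactly the lost ones ([irreversible_lost]), so that the
    palindromes of [u] are those of [v], and [2 r] is [n] plus a constant plus
    the number of palindromes of [v].  That number is the same for [n] and [n + 2]
    ([card_palindromesSS]): only one word of each length is right special, and
    every other palindrome [p] extends to exactly one palindrome [a p a], so the
    two counts differ by at most one; they have the same parity because
    [C + P] is even for [v], whose irreversible factors are none.  Hence [2 r]
    increases by 2.

    Conversely, if [r] gains one every two steps then [C <= 2 r <= n + cst].
    Being unbounded like [r], the complexity is strictly increasing, by the
    argument of Morse and Hedlund ([complexity_ltS]), so [C - n] is
    nondecreasing and bounded, and [u] is quasi-Sturmian. The same bounds hold for every
    suffix, so the number of lost factors is bounded, and some suffix [v] has
    all its factors recurrent ([recurrent_suffix]). If [v] had a factor [w]
    whose reversal is not a factor, every factor containing [w] would be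
    irreversible, and recurrence provides at least [n - |w|] of these
    ([many_irreversible]). Then [2 r >= C + I] would exceed [2 n - |w|], against
    [2 r <= n + cst]. *)

Set Implicit Arguments.
Unset Strict Implicit.
Unset Printing Implicit Defensive.

(** * Counting words up to reversal *)

Section ReflectionClasses.
Variables (A : finType) (n : nat).
Implicit Types (S T : {set n.-tuple A}) (w : n.-tuple A).

Definition irreversible S := [set w in S | rev_tuple w \notin S].
Definition palindromes S := [set w in S | rev_tuple w == w].
Definition classes S := equivalence_partition (@refl_equiv A n) S.

Lemma rev_tupleK : involutive (@rev_tuple n A).
Proof. by move=> w; apply/val_inj; rewrite /= revK. Qed.

Lemma card_setIdE S (P : pred (n.-tuple A)) :
  #|[set w in S | P w]| = \sum_(w in S) P w.
Proof.
rewrite -sum1dep_card big_mkcondr /=.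
by apply: eq_bigr => w _; case: (P w).
Qed.

(** Weighting a word by 1, plus 1 if it is irreversible, plus 1 if it is a
    palindrome gives every class total weight 2, whether the class is a pair
    of distinct mirror images, a palindrome or a word whose mirror image is
    missing. *)
Lemma double_card_classes S :
  #|classes S|.*2 = #|S| + #|irreversible S| + #|palindromes S|.
Proof.
pose g w := 1 + (rev_tuple w \notin S) + (rev_tuple w == w).
have -> : #|S| + #|irreversible S| + #|palindromes S| = \sum_(w in S) g w.
  by rewrite !card_setIdE -sum1_card -!big_split.
have eqR : {in S & &, equivalence_rel (@refl_equiv A n)}.
  by move=> x y z _ _ _; apply: refl_equiv_equivalence.
have /and3P[/eqP covS triv _] := equivalence_partitionP eqR.
rewrite -[in RHS]covS big_trivIset //= -muln2 -sum_nat_const.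
apply: eq_bigr => B /imsetP[x xS ->].
have memB y : (y \in [set y in S | refl_equiv x y]) =
              (y \in S) && ((y == x) || (y == rev_tuple x)).
  rewrite inE /refl_equiv eq_sym; congr (_ && (_ || _)).
  by rewrite -(inj_eq (inv_inj rev_tupleK)) rev_tupleK eq_sym.
have [px|npx] := eqVneq (rev_tuple x) x.
  rewrite (eq_bigl (pred1 x)) ?big_pred1_eq /g; first by rewrite px xS eqxx.
  by move=> y; rewrite memB px orbb /=; case: eqP => [->|]; rewrite ?xS ?andbF.
have [rS|nrS] := boolP (rev_tuple x \in S); last first.
  rewrite (eq_bigl (pred1 x)) ?big_pred1_eq /g.
    by rewrite nrS (negbTE npx).
  move=> y; rewrite memB /=; case: eqP => [->|_] /=; first by rewrite xS.
  by case: eqP => [->|]; rewrite ?(negbTE nrS) ?andbF.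
rewrite (bigD1 x) /=; last by rewrite memB xS eqxx.
rewrite (eq_bigl (pred1 (rev_tuple x))) ?big_pred1_eq; last first.
  move=> y; rewrite memB /=; case: (eqVneq y x) => [->|_].
    by rewrite andbF eq_sym (negbTE npx).
  by rewrite andbT /=; case: eqP => [->|]; rewrite ?rS ?andbF.
by rewrite /g rev_tupleK xS rS (negbTE npx) eq_sym (negbTE npx).
Qed.

Lemma card_classes_le S : #|classes S| <= #|S|.
Proof. exact: leq_imset_card. Qed.

Lemma card_classesS S T : S \subset T -> #|classes S| <= #|classes T|.
Proof.
move=> sST.
apply: leq_trans (leq_imset_card (fun B => B :&: S) _).
apply/subset_leq_card/subsetP => B /imsetP[x xS ->].
apply/imsetP; exists [set y in T | refl_equiv x y].
  by apply/imsetP; exists x => //; apply: (subsetP sST).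
apply/setP => y; rewrite !inE andbAC.
by case: (boolP (y \in S)) => [/(subsetP sST) ->|]; rewrite ?andbF.
Qed.

End ReflectionClasses.

(** * Factors of a sequence *)

Section Factors.
Variable A : finType.
Implicit Types u v : nat -> A.

Lemma factorsP u n (w : n.-tuple A) :
  reflect (exists i, w = window u i n) (w \in factors u n).
Proof. by rewrite inE; apply: asboolP. Qed.

Lemma window_factor u i n : window u i n \in factors u n.
Proof. by apply/factorsP; exists i. Qed.

Lemma eq_windowP u v i j n :
  (window u i n = window v j n) <-> (forall t, t < n -> u (i + t) = v (j + t)).
Proof.
split=> [e t tn|e]; last first.
  by apply: eq_from_tnth => t; rewrite !tnth_mktuple e.
by have := congr1 (fun w => tnth w (Ordinal tn)) e; rewrite !tnth_mktuple.
Qed.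

Lemma tnth_rev_window u i n (t : 'I_n) :
  tnth (rev_tuple (window u i n)) t = u (i + (n - t.+1)).
Proof.
have n_gt0 : n - t.+1 < n by have := ltn_ord t; lia.
rewrite (tnth_nth (u 0)) /= nth_rev size_map size_enum_ord //.
have -> : n - t.+1 = Ordinal n_gt0 by [].
by rewrite (nth_mktuple _ _ (Ordinal n_gt0)).
Qed.

Lemma eq_rev_windowP u v i j n :
  (rev_tuple (window u i n) = window v j n) <->
  (forall t, t < n -> u (i + (n - t.+1)) = v (j + t)).
Proof.
split=> [e t tn|e]; last first.
  by apply: eq_from_tnth => t; rewrite tnth_rev_window tnth_mktuple e.
have := congr1 (fun w => tnth w (Ordinal tn)) e.
by rewrite tnth_rev_window tnth_mktuple.
Qed.

Lemma closed_under_reversalP u :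
  closed_under_reversal u <->
  (forall n (w : n.-tuple A), w \in factors u n -> rev_tuple w \in factors u n).
Proof.
split=> [cu n w wF|cu w [n [v vF <-]]]; last first.
  by exists n, (rev_tuple v) => //; apply: cu.
have [m [v vF ev]] : language u (rev w) by apply: cu; exists n, w.
have em : m = n by rewrite -(size_tuple v) ev size_rev size_tuple.
by subst m; rewrite (_ : rev_tuple w = v) //; apply: val_inj.
Qed.

Lemma window_suffix u k i n :
  window (suffix_from u k) i n = window u (k + i) n.
Proof. by apply/eq_windowP => t _; rewrite /suffix_from addnA. Qed.

Lemma factors_suffixS u k l n : k <= l ->
  factors (suffix_from u l) n \subset factors (suffix_from u k) n.
Proof.
move=> kl; apply/subsetP => w /factorsP[i ->]; apply/factorsP.
by exists (l - k + i); rewrite !window_suffix addnA subnKC.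
Qed.

Lemma suffix_from0 u : suffix_from u 0 = u.
Proof. by apply/funext => i. Qed.

Lemma factors_suffix u k n :
  factors (suffix_from u k) n \subset factors u n.
Proof. by rewrite -{2}(suffix_from0 u) factors_suffixS. Qed.

Definition wprefix n (w : n.+1.-tuple A) : n.-tuple A :=
  [tuple tnth w (widen_ord (leqnSn n) j) | j < n].

Definition wsuffix n (w : n.+1.-tuple A) : n.-tuple A :=
  [tuple tnth w (lift ord0 j) | j < n].

Lemma wprefix_window u i n : wprefix (window u i n.+1) = window u i n.
Proof. by apply: eq_from_tnth => j; rewrite !tnth_mktuple. Qed.

Lemma wsuffix_window u i n : wsuffix (window u i n.+1) = window u i.+1 n.
Proof.
by apply: eq_from_tnth => j; rewrite !tnth_mktuple lift0 addnS addSn.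
Qed.

Lemma wprefix_factor u n w : w \in factors u n.+1 -> wprefix w \in factors u n.
Proof. by move=> /factorsP[i ->]; rewrite wprefix_window window_factor. Qed.

Lemma wsuffix_factor u n w : w \in factors u n.+1 -> wsuffix w \in factors u n.
Proof. by move=> /factorsP[i ->]; rewrite wsuffix_window window_factor. Qed.

Lemma window_factor_shorter u v i m n : m <= n ->
  window u i n \in factors v n -> window u i m \in factors v m.
Proof.
move=> mn /factorsP[j /eq_windowP e]; apply/factorsP; exists j.
by apply/eq_windowP => t tm; apply: e; apply: leq_trans mn.
Qed.

Lemma wprefix_factors u n : @wprefix n @: factors u n.+1 = factors u n.
Proof.
apply/setP => w; apply/imsetP/idP => [[x xF ->]|/factorsP[i ->]].
  exact: wprefix_factor.
by exists (window u i n.+1); rewrite ?window_factor ?wprefix_window.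
Qed.

(** * Growth of the complexity *)

Lemma complexity_leS u n : complexity u n <= complexity u n.+1.
Proof. by rewrite /complexity -wprefix_factors leq_imset_card. Qed.

(** If no factor of length [n] is right special then none of length [n.+1] is,
    since the letter following a word is already forced by its suffix. *)
Lemma complexity_constS u n :
  complexity u n.+1 = complexity u n -> complexity u n.+2 = complexity u n.+1.
Proof.
rewrite /complexity => e_card.
have inj : {in factors u n.+1 &, injective (@wprefix n)}.
  by apply/imset_injP; rewrite wprefix_factors e_card.
rewrite -(wprefix_factors u n.+1) card_in_imset //.
move=> x y /factorsP[i ->] /factorsP[j ->].
rewrite !wprefix_window => /eq_windowP e; apply/eq_windowP => t.
have /eq_windowP es : window u i.+1 n.+1 = window u j.+1 n.+1.
  apply: inj; rewrite ?window_factor // !wprefix_window.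
  by apply/eq_windowP => s sn; rewrite !addSnnS e.
case: t => [_|t]; first exact: e.
by move=> tn; rewrite -!addSnnS es.
Qed.

(** Once the complexity stops growing it is constant for ever. *)
Lemma complexity_ltS u :
  (forall K, exists n, K < complexity u n) ->
  forall n, complexity u n < complexity u n.+1.
Proof.
move=> unb n; rewrite ltnNge; apply/negP => le.
have e0 : complexity u n.+1 = complexity u n.
  by apply/eqP; rewrite eqn_leq le complexity_leS.
have step d : complexity u (n + d).+1 = complexity u (n + d).
  by elim: d => [|d IH]; rewrite ?addn0 // addnS; apply: complexity_constS.
have cst d : complexity u (n + d) = complexity u n.
  by elim: d => [|d IH]; rewrite ?addn0 // addnS step.
have mono : {homo complexity u : i j / i <= j}.
  by apply: homo_leq => //; [apply: leq_trans | apply: complexity_leS].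
have [m] := unb (complexity u n).
by rewrite ltnNge -(cst m) mono // leq_addl.
Qed.

Definition deficit u k n := #|factors u n :\: factors (suffix_from u k) n|.

Lemma complexity_suffix u k n :
  complexity u n = complexity (suffix_from u k) n + deficit u k n.
Proof.
rewrite /complexity -(cardsID (factors (suffix_from u k) n) (factors u n)).
by rewrite (setIidPr (factors_suffix u k n)).
Qed.

(** A word that has left the language of a suffix cannot come back into it
    after being prolonged to the right. *)
Lemma deficit_leS u k n : deficit u k n <= deficit u k n.+1.
Proof.
apply: leq_trans (leq_imset_card (@wprefix n) _).
apply/subset_leq_card/subsetP => w /setDP[/factorsP[i ->] niv].
apply/imsetP; exists (window u i n.+1); last by rewrite wprefix_window.
rewrite inE window_factor andbT; apply: contra niv => /wprefix_factor.
by rewrite wprefix_window.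
Qed.

Lemma deficit_le u k l m n : k <= l -> m <= n -> deficit u k m <= deficit u l n.
Proof.
move=> kl mn; apply: (@leq_trans (deficit u k n)).
  have mono : {homo deficit u k : i j / i <= j}.
    by apply: homo_leq => //; [apply: leq_trans | apply: deficit_leS].
  exact: mono.
by apply/subset_leq_card/setDS/factors_suffixS.
Qed.

Lemma factors_lost u k n w :
  w \in factors u n -> w \notin factors (suffix_from u k) n ->
  exists2 i, i < k & w = window u i n.
Proof.
move=> /factorsP[i ->] nv; exists i => //; rewrite ltnNge; apply: contra nv.
by move=> ki; apply/factorsP; exists (i - k); rewrite window_suffix subnKC.
Qed.

Lemma deficit_bound u k n : deficit u k n <= k.
Proof.
rewrite -[leqRHS]card_ord -cardsT.
apply: leq_trans (leq_imset_card (fun i : 'I_k => window u i n) _).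
apply/subset_leq_card/subsetP => w /setDP[wu /(factors_lost wu)[i ik ->]].
by apply/imsetP; exists (Ordinal ik).
Qed.

End Factors.

Lemma bounded_stabilizes (f : nat -> nat) N K :
  (forall n, f n <= f n.+1) -> (forall n, N <= n -> f n <= K) ->
  exists M, forall n, M <= n -> f n = f M.
Proof.
move=> fS fK.
have mono : {homo f : i j / i <= j}.
  by apply: homo_leq => //; apply: leq_trans.
have ex : exists m, `[< exists n, f n = m >].
  by exists (f 0); apply/asboolP; exists 0.
have bd m : `[< exists n, f n = m >] -> m <= K.
  move=> /asboolP[n <-]; apply: leq_trans (fK (maxn N n) _).
    by apply: mono; rewrite leq_maxr.
  by rewrite leq_maxl.
case: (ex_maxnP ex bd) => m /asboolP[M <-] max.
exists M => n Mn; apply/eqP; rewrite eqn_leq [X in _ && X]mono // andbT.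
by apply: max; apply/asboolP; exists n.
Qed.

(** When a surjection misses injectivity by one element, removing either point
    of its only collision makes it injective. *)
Lemma almost_injective (T T' : finType) (f : T -> T') (S : {set T})
    (S' : {set T'}) :
  f @: S = S' -> #|S| = #|S'|.+1 ->
  exists2 s, s \in S & {in S :\ s &, injective f}.
Proof.
move=> fS cS.
have /existsNP[x /existsNP[y /not_implyP[xS /not_implyP[yS
       /not_implyP[exy /eqP nxy]]]]] : ~ {in S &, injective f}.
  by move=> /imset_injP; rewrite fS cS => /eqP; lia.
exists x => //; apply/imset_injP.
suff -> : f @: (S :\ x) = S' by move: cS; rewrite (cardsD1 x) xS => /eqP; lia.
rewrite -fS; apply/setP => z; apply/imsetP/imsetP => -[w wS ->].
  by exists w => //; move: wS => /setD1P[].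
have [->|nwx] := eqVneq w x; last by exists w => //; apply/setD1P.
by exists y => //; apply/setD1P; rewrite eq_sym.
Qed.

(** * Palindromes of a language closed under reversal *)

Section Palindromes.
Variables (A : finType) (u : nat -> A).

Definition trim n (w : n.+2.-tuple A) : n.-tuple A := wprefix (wsuffix w).

Lemma palindromeP n (w : n.-tuple A) :
  reflect (exists2 i, w = window u i n & forall t, t < n ->
             u (i + (n - t.+1)) = u (i + t))
          (w \in palindromes (factors u n)).
Proof.
rewrite inE; apply: (iffP andP) => [[/factorsP[i ->] /eqP/eq_rev_windowP e]|].
  by exists i.
by case=> i -> e; rewrite window_factor; split=> //; apply/eqP/eq_rev_windowP.
Qed.

Lemma trim_palindrome n w :
  w \in palindromes (factors u n.+2) -> trim w \in palindromes (factors u n).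
Proof.
move=> /palindromeP[i -> e]; apply/palindromeP; exists i.+1.
  by rewrite /trim wsuffix_window wprefix_window.
move=> t tn; rewrite !addSnnS -(e t.+1); last lia.
by congr (u (i + _)); lia.
Qed.

(** The first letter of a palindrome is also its last one, hence is still
    visible after deleting it. *)
Lemma wsuffix_palindrome_inj n :
  {in palindromes (factors u n.+2) &, injective (@wsuffix A n.+1)}.
Proof.
move=> x y /palindromeP[i -> ei] /palindromeP[j -> ej].
rewrite !wsuffix_window => /eq_windowP e; apply/eq_windowP => -[_|t tn].
  rewrite -(ei 0) // -(ej 0) // subn1 /= -!addSnnS; exact: e.
by rewrite -!addSnnS e.
Qed.

(** A palindrome [p] that is not right special extends only by one letter [a];
    since the language is closed under reversal, [rev (p a)] is also a factor,
    and the letter that follows it is again [a]. *)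
Lemma palindrome_extension n (p : n.-tuple A) :
  closed_under_reversal u ->
  {in factors u n.+1 &, forall x y,
     wprefix x = p -> wprefix y = p -> x = y} ->
  p \in palindromes (factors u n) ->
  exists2 w, w \in palindromes (factors u n.+2) & trim w = p.
Proof.
move=> /closed_under_reversalP u_rev uniq /palindromeP[i ep_i e].
rewrite {}ep_i in uniq *.
have /u_rev/factorsP[j ej] := window_factor u i n.+1.
have {}ej t : t < n.+1 -> u (i + (n.+1 - t.+1)) = u (j + t).
  by move/eq_rev_windowP: ej; apply.
have ep : window u j.+1 n = window u i n.
  apply/eq_windowP => t tn; rewrite addSnnS -ej // -(e t) //.
have /eq_windowP eS : window u j.+1 n.+1 = window u i n.+1.
  by apply: uniq; rewrite ?window_factor ?wprefix_window.
exists (window u j n.+2); last by rewrite /trim wsuffix_window wprefix_window.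
apply/palindromeP; exists j => // t tn.
have sym s : s < n.+1 -> u (j + (n.+1 - s)) = u (j + s).
  move=> sn; rewrite -(ej s) // subSS (@subSn s n) // -addSnnS eS //.
  by rewrite ltnS leq_subr.
have [->|tn1] := eqVneq t n.+1; last by rewrite subSS sym //; lia.
by rewrite subnn -(sym 0) // subn0.
Qed.

(** Only one factor of length [n] is right special, and it has two right
    extensions: away from it trimming is a bijection between palindromes,
    so the two counts differ by at most one. They agree because both have the
    parity of the complexity. *)
Lemma card_palindromesSS n :
  closed_under_reversal u ->
  complexity u n.+1 = (complexity u n).+1 ->
  complexity u n.+2 = (complexity u n.+1).+1 ->
  #|palindromes (factors u n.+2)| = #|palindromes (factors u n)|.
Proof.
move=> u_rev C1 C2; set P2 := palindromes _; set P0 := palindromes _.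
(* [s0] is one of the two extensions of the right special word [wprefix s0]. *)
have [s0 s0F inj] : exists2 s0, s0 \in factors u n.+1 &
    {in factors u n.+1 :\ s0 &, injective (@wprefix A n)}.
  exact: almost_injective (wprefix_factors u n) C1.
(* At most one palindrome [w] has [wsuffix w = s0]; trimming separates the
   others. *)
have le20 : #|P2| <= #|P0|.+1.
  rewrite -(cardsID [set w | wsuffix w == s0] P2) -(add1n #|P0|) leq_add //.
    apply/card_le1_eqP => x y /setIP[xP xs] /setIP[yP ys].
    apply: wsuffix_palindrome_inj => //.
    by move: xs ys; rewrite !inE => /eqP-> /eqP->.
  rewrite -(card_in_imset (f := @trim n)); last first.
    have good x : x \in P2 :\: [set w | wsuffix w == s0] ->
        wsuffix x \in factors u n.+1 :\ s0.
      move=> /setDP[/setIdP[xF _] xs]; apply/setD1P; split.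
        by apply: contra xs; rewrite inE.
      exact: wsuffix_factor.
    move=> x y xP yP e; case/setDP: (xP) (yP) => xP2 _ /setDP[yP2 _].
    by apply: wsuffix_palindrome_inj => //; apply: inj => //; apply: good.
  apply/subset_leq_card/subsetP => w /imsetP[x /setDP[xP _] ->].
  exact: trim_palindrome.
have le02 : #|P0| <= #|P2|.+1.
  rewrite (cardsD1 (wprefix s0)) -(add1n #|P2|) leq_add ?leq_b1 //.
  apply: leq_trans (leq_imset_card (@trim n) _).
  apply/subset_leq_card/subsetP => p /setD1P[ps pP].
  have [|w wP <-] := palindrome_extension u_rev _ pP; last exact: imset_f.
  have good x : x \in factors u n.+1 -> wprefix x = p ->
      x \in factors u n.+1 :\ s0.
    move=> xF xp; apply/setD1P; split=> //.
    by apply: contraNneq ps => <-; rewrite xp.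
  by move=> x y xF yF ex ey; apply: inj; rewrite ?good // ex ey.
have irr m : #|irreversible (factors u m)| = 0.
  apply: eq_card0 => w; rewrite inE; apply/andP => -[wF /negP[]].
  by move/closed_under_reversalP: u_rev; apply.
have := double_card_classes (factors u n.+2).
have := double_card_classes (factors u n).
rewrite !irr -!/(complexity _ _) -/P2 -/P0; lia.
Qed.

End Palindromes.

Section Suffixes.
Variables (A : finType) (u : nat -> A).

(** * Prefixes lost by a suffix closed under reversal *)

(** A factor [w] lost by the suffix starts before position [k], and so does
    its short prefix [p] that is already lost.  If [rev w] occurred in [u] its
    end [rev p] would lie beyond position [k], hence in the suffix, and so
    would [p]. *)
Lemma irreversible_lost k :
  closed_under_reversal (suffix_from u k) ->
  exists N, forall n, N <= n ->
    irreversible (factors u n) = factors u n :\: factors (suffix_from u k) n.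
Proof.
set v := suffix_from u k => /closed_under_reversalP v_rev.
have /choice[f fP] i : exists m, forall n,
    window u i n \notin factors v n -> window u i m \notin factors v m.
  have [[m mP]|no] := pselect (exists m, window u i m \notin factors v m).
    by exists m.
  by exists 0 => n nP; case: no; exists n.
pose N := \max_(i < k) f i; exists (N + k) => n nN.
apply/setP => w; apply/setIdP/setDP => -[wF nw]; split=> //.
  apply: contra nw => /v_rev; exact: (subsetP (factors_suffix u k n)).
have [i ik ew] := factors_lost wF nw; rewrite {w}ew in wF nw *.
have fN : f i <= N by apply: (leq_bigmax (Ordinal ik)).
have lost : window u i N \notin factors v N.
  by apply: contra (fP _ _ nw); apply: window_factor_shorter.
apply: contra lost => /factorsP[j /eq_rev_windowP e].
suff <- : rev_tuple (window v (j + (n - N) - k) N) = window u i N.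
  exact/v_rev/window_factor.
rewrite window_suffix; apply/eq_rev_windowP => t tN.
have tn : n - t.+1 < n by lia.
rewrite (_ : k + _ + _ = j + (n - t.+1)); last lia.
by rewrite -e //; congr (u (i + _)); lia.
Qed.

(** A palindrome is never irreversible, so none of them is lost. *)
Lemma palindromes_of_lost_irreversible n (S T : {set n.-tuple A}) :
  T \subset S ->
  irreversible S = S :\: T -> palindromes S = palindromes T.
Proof.
move=> sTS irr; apply/setP => w; apply/setIdP/setIdP => -[wS /eqP e].
  split; last exact/eqP.
  have : w \notin irreversible S by rewrite inE e wS.
  by rewrite irr inE wS andbT negbK.
by split; [apply: (subsetP sTS) | apply/eqP].
Qed.

Lemma reflection_complexity_of_closed_suffix k :
  quasi_sturmian u -> closed_under_reversal (suffix_from u k) ->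
  exists N, forall n, N <= n ->
    reflection_complexity u (n + 2) = reflection_complexity u n + 1.
Proof.
move=> [n0 [c Cu]] v_rev; set v := suffix_from u k in v_rev *.
have [N1 irr] := irreversible_lost v_rev.
have [N2 stab] : exists N, forall n, N <= n -> deficit u k n = deficit u k N.
  apply: (@bounded_stabilizes _ 0 k) => n; first exact: deficit_leS.
  by move=> _; apply: deficit_bound.
exists (n0 + N1 + N2) => n nN; rewrite addn2.
have Cv m : n0 + N1 + N2 <= m -> complexity v m.+1 = (complexity v m).+1.
  move=> mN.
  have := complexity_suffix u k m; have := complexity_suffix u k m.+1.
  rewrite !Cu ?stab -/v; lia.
have r_eq m : n0 + N1 + N2 <= m ->
    (reflection_complexity u m).*2 =
    complexity u m + deficit u k m + #|palindromes (factors v m)|.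
  move=> mN; have irr_m := irr m ltac:(lia).
  rewrite [LHS]double_card_classes irr_m.
  by rewrite (palindromes_of_lost_irreversible (factors_suffix u k m) irr_m).
have := card_palindromesSS v_rev (Cv n ltac:(lia)) (Cv n.+1 ltac:(lia)).
have := r_eq n ltac:(lia); have := r_eq n.+2 ltac:(lia).
rewrite !Cu ?stab; lia.
Qed.

(** * Recurrence *)

(** The deficit is monotone in both arguments, so once it is bounded it is
    constant on a whole quadrant, and there later suffixes lose nothing. *)
Lemma recurrent_suffix N K :
  (forall k n, N <= n -> deficit u k n <= K) ->
  exists k, forall l n,
    factors (suffix_from (suffix_from u k) l) n = factors (suffix_from u k) n.
Proof.
move=> bd.
have [M stab] : exists M, forall n, M <= n -> deficit u n n = deficit u M M.
  apply: (@bounded_stabilizes (fun n => deficit u n n) N K) => n.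
    by apply: deficit_le.
  exact: bd.
have stab2 l n : M <= l -> M <= n -> deficit u l n = deficit u M M.
  move=> Ml Mn; apply/eqP; rewrite eqn_leq [X in _ && X]deficit_le // andbT.
  by rewrite -(stab (l + n)) ?deficit_le ?leq_addr ?leq_addl //; lia.
exists M => l n; apply/eqP; rewrite eqEsubset factors_suffix /=.
have -> : suffix_from (suffix_from u M) l = suffix_from u (M + l).
  by apply/funext => i; rewrite /suffix_from addnA.
(* Equality is known for lengths at least [M]; shorter factors are prolonged. *)
have eqF : factors (suffix_from u (M + l)) (M + n) =
           factors (suffix_from u M) (M + n).
  apply/eqP; rewrite eqEcard factors_suffixS ?leq_addr //=.
  rewrite -!/(complexity _ _).
  have := complexity_suffix u (M + l) (M + n).
  have := complexity_suffix u M (M + n).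
  rewrite (stab2 (M + l)) ?(stab2 M) ?leq_addr //; lia.
apply/subsetP => w /factorsP[i ->].
apply: (window_factor_shorter (leq_addl M n)).
by rewrite eqF window_factor.
Qed.

(** * Words whose reversal is not a factor *)

(** Either every factor of length [n] contains [w], or, by recurrence, [w]
    occurs just after a gap; the windows that slide over this occurrence are
    told apart by the place where they first meet [w]. *)
Lemma many_irreversible (v : nat -> A) l (w : l.-tuple A) :
  (forall k n, factors (suffix_from v k) n = factors v n) ->
  (forall n, n < complexity v n) ->
  w \in factors v l -> rev_tuple w \notin factors v l ->
  forall n, n - l <= #|irreversible (factors v n)|.
Proof.
move=> rec Cn wF wR n.
have [nl|/ltnW ln] := leqP n l; first by rewrite (eqP nl).
have irr i t : t <= n - l -> window v (i + t) l = w ->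
    window v i n \in irreversible (factors v n).
  move=> tn ew; rewrite inE window_factor; apply: contra wR => /factorsP[j].
  move=> /eq_rev_windowP e; apply/factorsP; exists (j + (n - (t + l))).
  rewrite -ew; apply/eq_rev_windowP => s sl.
  rewrite -(addnA j) -e; last lia.
  by congr v; lia.
have [[i gap]|no_gap] :=
    pselect (exists i, forall t, t <= n - l -> window v (i + t) l != w).
  have occ : exists j, (i <= j) && (window v j l == w).
    move: wF; rewrite -(rec i) => /factorsP[j ->]; exists (i + j).
    by rewrite leq_addr window_suffix /=.
  case: (ex_minnP occ) => j /andP[ij /eqP wj] j_min.
  have jn : i + (n - l) < j.
    rewrite ltnNge; apply/negP => ji; have /eqP[] := gap (j - i) ltac:(lia).
    by rewrite subnKC.
  have first t s : t < s <= n - l -> window v (j - s + t) l != w.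
    move=> ts; apply/negP => /eqP we; have := j_min (j - s + t).
    by rewrite we eqxx andbT; lia.
  (* By minimality of [j], [w] first occurs in [f t] at offset [t]. *)
  pose f (t : 'I_(n - l)) := window v (j - t) n.
  have f_inj : injective f.
    have lt (s t : 'I_(n - l)) : s < t -> f s != f t.
      move=> st; have tn := ltn_ord t.
      apply/negP => /eqP/eq_windowP e.
      have /negP[] := first s t ltac:(lia).
      rewrite -wj; apply/eqP/eq_windowP => q ql.
      rewrite -addnA -e; last lia.
      by congr v; lia.
    move=> s t est; apply/val_inj/eqP; rewrite eqn_leq.
    by apply/andP; split; rewrite leqNgt; apply/negP => /lt; rewrite est eqxx.
  rewrite -[leqLHS]card_ord -(card_imset _ f_inj).
  apply/subset_leq_card/subsetP => x /imsetP[t _ ->].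
  have tn := ltn_ord t.
  apply: (irr _ t); first lia.
  by rewrite subnK //; lia.
suff -> : irreversible (factors v n) = factors v n.
  by apply: leq_trans (ltnW (Cn n)); apply: leq_subr.
apply/setP => x; rewrite [LHS]inE; apply: andb_idr => /factorsP[i ->].
have [t tn ew] : exists2 t, t <= n - l & window v (i + t) l = w.
  apply: contrapT => no; apply: no_gap; exists i => t tn.
  by apply/eqP => ew; apply: no; exists t.
by have := irr i t tn ew; rewrite inE => /andP[].
Qed.

(** The reflection complexity grows like [n / 2] whereas the complexity grows
    like [n]: no room is left for many irreversible words. *)
Lemma quasi_sturmian_of_reflection_complexity N :
  (forall n, N <= n ->
     reflection_complexity u (n + 2) = reflection_complexity u n + 1) ->
  quasi_sturmian u /\ exists k, closed_under_reversal (suffix_from u k).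
Proof.
move=> r_step.
(* Twice the sum of both starting values serves for either parity of [n]. *)
pose K := (reflection_complexity u N + reflection_complexity u N.+1).*2.
have r_le n : N <= n -> (reflection_complexity u n).*2 <= n + K.
  elim/ltn_ind: n => n IH Nn.
  have [e|ne] := eqVneq n N; first by rewrite e /K; lia.
  have [e|ne1] := eqVneq n N.+1; first by rewrite e /K; lia.
  have := r_step (n - 2) ltac:(lia); have := IH (n - 2) ltac:(lia) ltac:(lia).
  by rewrite subnK; lia.
have r_unb m : exists n, m < reflection_complexity u n.
  exists (N + m.+1.*2); have -> // : forall d,
    reflection_complexity u (N + d.*2) = reflection_complexity u N + d.
    elim=> [|d IH]; first by rewrite !addn0.
    by rewrite doubleS -addn2 addnA r_step ?leq_addr // IH; lia.
  by lia.
have C_ge v n : (complexity v n <= (reflection_complexity v n).*2).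
  by rewrite [leqRHS]double_card_classes -addnA leq_addr.
have C_lt k n : n < complexity (suffix_from u k) n.
  have C_ltS : forall m,
      complexity (suffix_from u k) m < complexity (suffix_from u k) m.+1.
    apply: complexity_ltS => m; have [p p_big] := r_unb (m + k); exists p.
    have := card_classes_le (factors u p).
    rewrite -/(reflection_complexity _ _) -/(complexity _ _).
    have := complexity_suffix u k p; have := deficit_bound u k p; lia.
  elim: n => [|n IH]; last by apply: leq_ltn_trans IH (C_ltS n).
  apply/card_gt0P; exists (window (suffix_from u k) 0 0).
  exact: window_factor.
have C_le n : N <= n -> complexity u n <= n + K.
  by move=> /r_le; apply: leq_trans; apply: C_ge.
split.
  have C_gt n : n < complexity u n by rewrite -(suffix_from0 u) C_lt.
  have [|n Nn|M stab] := @bounded_stabilizes (fun n => complexity u n - n) N K.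
  - move=> n; have : complexity u n < complexity u n.+1; last lia.
    apply: complexity_ltS => m; exists m; exact: C_gt.
  - by have := C_le n Nn; lia.
  exists M, (complexity u M - M) => n Mn; rewrite -(stab n Mn).
  by have := C_gt n; lia.
have [k rec] : exists k, forall l n,
    factors (suffix_from (suffix_from u k) l) n = factors (suffix_from u k) n.
  apply: (@recurrent_suffix N K) => k n Nn.
  by have := complexity_suffix u k n; have := C_lt k n; have := C_le n Nn; lia.
exists k; apply/closed_under_reversalP => l w wF.
apply: contrapT => /negP wR.
set v := suffix_from u k in rec wF wR *.
(* Large enough for [2 n - l] to exceed [n + K]. *)
pose n := N + l + K.+1.
have := many_irreversible rec (C_lt k) wF wR n.
have := double_card_classes (factors v n).
have := card_classesS (factors_suffix u k n).
have := r_le n ltac:(lia); have := C_lt k n.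
rewrite -!/(reflection_complexity _ _) -!/(complexity _ _) -/v; lia.
Qed.

End Suffixes.

Theorem theorem20 (A : finType) (u : nat -> A) :
  (exists N : nat, forall n : nat, N <= n ->
     reflection_complexity u (n + 2) = reflection_complexity u n + 1) <->
  (quasi_sturmian u /\
   exists k : nat, closed_under_reversal (suffix_from u k)).
Proof.
split=> [[N]|[u_qs [k]]]; first exact: quasi_sturmian_of_reflection_complexity.
exact: reflection_complexity_of_closed_suffix.
Qed.
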